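(* Let $K$ be a field, $r\geq 3$, $S=K[x_1,\ldots,x_r]$, and let $G$ be a simple graph without isolated vertices on the vertex set $[r]=\{1,\ldots,r\}$, with Stanley–Reisner ideal $I_G\subseteq S$. Then $$a_2^j(S/I_G^n)=a_2^j(S/I_G^{(n)})$$ for all $j\geq 0$ and $n\geq 1$. In particular, $a_2(S/I_G^n)=a_2(S/I_G^{(n)})$ for all $n\geq 1$.
   Context: A simple graph is an undirected graph with no loops and no parallel edges; $G$ is regarded as a one-dimensional simplicial complex with faces $\emptyset$, the vertices and the edges. $I_G=(\prod_{i\in F}x_i: F\subseteq[r] \text{ not a face})=\bigcap_{e\in E(G)}P_e$ with $P_e=(x_i: i\in[r]\setminus e)$. $I_G^{(n)}=\bigcap_{e\in E(G)}P_e^n$ is the $n$-th symbolic power. $\mathfrak m=(x_1,\ldots,x_r)$. For $\mathbf a=(a_1,\ldots,a_r)\in\mathbb Z^r$ put $|\mathbf a|=a_1+\cdots+a_r$ and $G_{\mathbf a}=\{i\in[r]: a_i<0\}$ (with cardinality $|G_{\mathbf a}|$). For a monomial ideal $T\subseteq S$, local cohomology $H^i_{\mathfrak m}(S/T)$ is $\mathbb Z^r$-graded, and $a_i^j(S/T):=\max\{|\mathbf a|: \mathbf a\in\mathbb Z^r,\ H^i_{\mathfrak m}(S/T)_{\mathbf a}\neq 0,\ |G_{\mathbf a}|=j\}$, $\ a_i(S/T):=\max\{t: H^i_{\mathfrak m}(S/T)_t\neq 0\}$ (degree $t$ in the standard grading), with $\max\emptyset=-\infty$. *)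

(* Defs.v *)
From HB Require Import structures.
(* Imported first and without notations: these clash with finset and mpoly. *)
From mathcomp Require Import -(notations) constructive_ereal classical_sets.
From mathcomp Require Import all_boot all_order all_algebra.
From mathcomp Require Import mpoly.

Set Implicit Arguments.
Unset Strict Implicit.
Unset Printing Implicit Defensive.

Import Order.TTheory GRing.Theory Num.Theory.
Local Open Scope ring_scope.

Section Ideals.
Variable R : comNzRingType.
Implicit Types A I : R -> Prop.

Definition ideal_gen A : R -> Prop := fun f =>
  exists s : seq (R * R),
    (forall p, p \in s -> A p.2) /\ f = \sum_(p <- s) p.1 * p.2.

Definition ideal_pow I (n : nat) : R -> Prop :=
  ideal_gen (fun f => exists2 g : 'I_n -> R,
    (forall i, I (g i)) & f = \prod_(i < n) g i).

End Ideals.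

(* Vertices are numbered from 0, as elements of 'I_r. *)
Section StanleyReisner.
Variables (K : fieldType) (r : nat) (e : rel 'I_r).
Implicit Types F : {set 'I_r}.

Definition is_face F : Prop :=
  [\/ F = set0, exists i, F = [set i] | exists i j, e i j /\ F = [set i; j]].

Definition SR_ideal : {mpoly K[r]} -> Prop :=
  ideal_gen (fun f => exists2 F, ~ is_face F & f = \prod_(i in F) 'X_i).

Definition edge_prime (i j : 'I_r) : {mpoly K[r]} -> Prop :=
  ideal_gen (fun f => exists2 k, k \notin [set i; j] & f = 'X_k).

Definition SR_symbolic_pow (n : nat) : {mpoly K[r]} -> Prop := fun f =>
  forall i j, e i j -> ideal_pow (edge_prime i j) n f.

End StanleyReisner.

Arguments SR_ideal K {r} e _.
Arguments SR_symbolic_pow K {r} e n _.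

(* H^i_m(S/T) is the cohomology of the Cech complex of S/T on x_1, ..., x_r,
   with C^i the direct sum of the (S/T)_{x_F} over #|F| = i, where x_F is the
   product of the x_l for l in F.  The localization S_{x_F} is a subring of the
   fraction field of S, and (S/T)_{x_F} = S_{x_F} / T_{x_F} since localization
   is exact.  A cochain is represented by a family (c F) of fractions, of which
   only the components with #|F| = i matter, considered modulo T_{x_F}. *)
Section LocalCohomology.
Variables (K : fieldType) (r : nat).
Local Notation S := {mpoly K[r]}.
Local Notation Q := {fraction {mpoly K[r]}}.
Implicit Types (T : S -> Prop) (F : {set 'I_r}).

Definition xprod F : S := \prod_(l in F) 'X_l.

Definition frac_over F (p : S) (k : nat) : Q :=
  tofrac p / tofrac (xprod F) ^+ k.

Definition loc F : Q -> Prop := fun f =>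
  exists (p : S) (k : nat), f = frac_over F p k.

Definition loc_ideal T F : Q -> Prop := fun f =>
  exists (p : S) (k : nat), T p /\ f = frac_over F p k.

(* The elements of degree d of S_{x_F}, for the grading of S by the abelian
   group A in which x_l has degree w l. *)
Definition loc_homog (A : zmodType) (w : 'I_r -> A) (d : A) F : Q -> Prop :=
  fun f => exists (p : S) (k : nat), f = frac_over F p k /\
    forall m, m \in msupp p ->
      \sum_(l < r) w l *+ m l = d + (\sum_(l in F) w l) *+ k.

Definition cech_diff (c : {set 'I_r} -> Q) F : Q :=
  \sum_(l in F) (-1) ^+ #|[set k in F | (k < l)%N]| * c (F :\ l).

(* The degree d component of H^i_m(S/T), that is, the set of classes of the
   cocycles that are homogeneous of degree d, is nonzero. *)
Definition locoh_neq0 (A : zmodType) (w : 'I_r -> A) T (i : nat) (d : A)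
    : Prop :=
  exists z : {set 'I_r} -> Q,
  [/\ forall F, #|F| = i -> loc_homog w d F (z F),
      forall F, #|F| = i.+1 -> loc_ideal T F (cech_diff z F)
    & ~ exists b : {set 'I_r} -> Q,
          (forall F, #|F|.+1 = i -> loc F (b F)) /\
          (forall F, #|F| = i -> loc_ideal T F (z F - cech_diff b F))].

Definition multi_wt (l : 'I_r) : 'rV[int]_r := delta_mx 0 l.
Definition std_wt (l : 'I_r) : int := 1.

Definition total_deg (a : 'rV[int]_r) : int := \sum_(l < r) a 0 l.
Definition neg_part (a : 'rV[int]_r) : {set 'I_r} := [set l | a 0 l < 0].

(* The least upper bound in the extended integers: the maximum of E when E is
   nonempty and bounded above (see max_degE), -oo when E is empty, and +oo when
   E is not bounded above. *)
Definition max_deg (E : int -> Prop) : extended int :=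
  supremum (ENInf int) (fun x => exists2 t : int, E t & x = EFin t).

Definition a_inv T (i : nat) : extended int :=
  max_deg (fun t => locoh_neq0 std_wt T i t).

Definition a_inv_neg T (i j : nat) : extended int :=
  max_deg (fun t => exists a : 'rV[int]_r,
    [/\ locoh_neq0 multi_wt T i a, #|neg_part a| = j & t = total_deg a]).

End LocalCohomology.

Lemma max_degE (E : int -> Prop) (t : int) :
  E t -> (forall s, E s -> s <= t) -> max_deg E = EFin t.
Proof.
move=> Et ub; rewrite /max_deg /supremum.
set B := (X in X == _).
have Bt : B (EFin t) by exists t.
case: eqP => [B0|_]; first by move: Bt; rewrite B0.
have supt : supremums B (EFin t).
  split; first by move=> _ [s Es ->]; rewrite lee_fin ub.
  by move=> y; apply.
case: xgetP => [y _ suy|/(_ (EFin t))]; last by [].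
exact: (is_subset1_supremums suy supt).
Qed.

Lemma max_deg0 (E : int -> Prop) : (forall t, ~ E t) -> max_deg E = ENInf int.
Proof.
move=> E0; rewrite /max_deg /supremum; case: eqP => // -[].
by rewrite boolp.predeqE => x; split => // -[t /E0].
Qed.

(* Main.v *)
Require Import Defs.
From mathcomp Require Import all_boot all_order all_algebra.
From mathcomp Require Import mpoly.

(** The Čech description of [H^2_m(S/T)] sees the ideal [T] only through its
    localizations [T_{x_F}] with [#|F| = 2] (cochains modulo [T]) and
    [#|F| = 3] (the cocycle condition): the module [C^1] enters merely as the
    source of coboundaries, for which any representatives in [S_{x_F}] do.
    Hence two ideals with the same localizations at all these [F] have the same
    [H^2_m], degree by degree and for every grading ([locoh2_neq0_eq]).

    It remains to compare the ordinary and the symbolic power of [I_G] after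
    inverting at least two variables ([loc_ideal_SR_symbolic]).  One has
    [I_G^n <= I_G^(n)] because no nonface is contained in an edge, so that
    [I_G <= P_e].  For the other inclusion let [F] have at least two elements.
    If [F] is not a face, then [x_F] lies in [I_G], so [x_F ^ n] multiplies
    everything into [I_G^n].  If [F] is a face, it is an edge [{i, j}]; then
    [{i, j, k}] is a nonface for every other [k], so [x_F P_F <= I_G], and
    [x_F ^ n] multiplies [P_F^n], hence [I_G^(n)], into [I_G^n].

    So the sets of degrees whose maxima are compared are equal. *)

Set Implicit Arguments.
Unset Strict Implicit.
Unset Printing Implicit Defensive.

Import Order.TTheory GRing.Theory Num.Theory.
Local Open Scope ring_scope.

Section IdealLemmas.
Variable R : comNzRingType.
Implicit Types (A B I J : R -> Prop) (f g u : R).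

Lemma mem_ideal_gen A f g : A f -> ideal_gen A (g * f).
Proof.
move=> Af; exists [:: (g, f)]; split; last by rewrite big_seq1.
by move=> p; rewrite inE => /eqP ->.
Qed.

Lemma ideal_genM A f g : ideal_gen A f -> ideal_gen A (g * f).
Proof.
case=> s [sA ->]; exists [seq (g * p.1, p.2) | p <- s]; split.
  by move=> _ /mapP [p ps ->]; exact: (sA p ps).
by rewrite big_map mulr_sumr; apply: eq_bigr => p _; rewrite mulrA.
Qed.

Lemma ideal_genD A f g :
  ideal_gen A f -> ideal_gen A g -> ideal_gen A (f + g).
Proof.
case=> s [sA ->] [t [tA ->]]; exists (s ++ t); split; last by rewrite big_cat.
by move=> p; rewrite mem_cat => /orP [/sA|/tA].
Qed.

Lemma ideal_gen0 A : ideal_gen A 0.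
Proof. by exists [::]; split; last rewrite big_nil. Qed.

(** The common factor [u] lets one statement cover both monotonicity ([u = 1])
    and inclusions that hold only after inverting [u]. *)
Lemma ideal_gen_colon A B u f :
  (forall g, A g -> ideal_gen B (u * g)) ->
  ideal_gen A f -> ideal_gen B (u * f).
Proof.
move=> AB [s [sA ->]]; rewrite mulr_sumr.
rewrite big_seq; elim/big_ind: _ => [|x y|p ps].
- exact: ideal_gen0.
- exact: ideal_genD.
- by rewrite mulrCA; apply/ideal_genM/AB/sA.
Qed.

Lemma ideal_pow_colon I J u n f :
  (forall g, I g -> J (u * g)) ->
  ideal_pow I n f -> ideal_pow J n (u ^+ n * f).
Proof.
move=> IJ; apply: ideal_gen_colon => _ [g gI ->].
rewrite -[X in ideal_gen _ X]mul1r; apply: mem_ideal_gen.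
exists (fun i => u * g i) => [i|]; first exact/IJ/gI.
by rewrite big_split prodr_const card_ord.
Qed.

Lemma ideal_pow_sub I J n f :
  (forall g, I g -> J g) -> ideal_pow I n f -> ideal_pow J n f.
Proof.
move=> IJ /(@ideal_pow_colon I J 1); rewrite expr1n mul1r.
by apply=> g; rewrite mul1r; apply: IJ.
Qed.

Lemma mem_ideal_powX I u n f : I u -> ideal_pow I n (u ^+ n * f).
Proof.
move=> Iu; rewrite mulrC; apply: mem_ideal_gen.
by exists (fun=> u) => //; rewrite prodr_const card_ord.
Qed.

End IdealLemmas.

Section SRPowers.
Variables (K : fieldType) (r : nat) (e : rel 'I_r).
Implicit Types (F : {set 'I_r}) (T U : {mpoly K[r]} -> Prop).

Lemma nonface_SR_ideal F : ~ is_face e F -> SR_ideal K e (xprod K F).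
Proof.
move=> nF; rewrite -[xprod _ _]mul1r; apply: mem_ideal_gen.
by exists F.
Qed.

Lemma subset_edge_face i j F :
  e i j -> F \subset [set i; j] -> is_face e F.
Proof.
move=> eij; rewrite -subDset subset1.
have [iF|iF] := boolP (i \in F).
  rewrite -{3}(setD1K iF); case/orP=> /eqP ->.
    by apply: Or33; exists i, j.
  by apply: Or32; exists i; rewrite setU0.
have -> : F :\ i = F by apply/setDidPl; rewrite disjoint_sym disjoints1.
by case/orP=> /eqP ->; [apply: Or32; exists j | apply: Or31].
Qed.

Lemma SR_ideal_sub_edge_prime i j f :
  e i j -> SR_ideal K e f -> edge_prime i j f.
Proof.
move=> eij; rewrite -[f in edge_prime _ _ f]mul1r.
apply: ideal_gen_colon => _ [F nF ->]; rewrite mul1r.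
have /subsetPn [k kF kij] : ~~ (F \subset [set i; j]).
  by apply/negP => /(subset_edge_face eij).
by rewrite (bigD1 k) //= mulrC; apply: mem_ideal_gen; exists k.
Qed.

Lemma SR_pow_sub_symbolic n f :
  ideal_pow (SR_ideal K e) n f -> SR_symbolic_pow K e n f.
Proof.
move=> If i j eij; apply: ideal_pow_sub If => g.
exact: SR_ideal_sub_edge_prime.
Qed.

Lemma face_card_gt1 F : is_face e F -> (1 < #|F|)%N ->
  exists i j, e i j /\ F = [set i; j].
Proof. by case=> [->|[i ->]|//]; rewrite ?cards0 ?cards1. Qed.

Lemma face_card_le2 F : is_face e F -> (#|F| <= 2)%N.
Proof.
case=> [->|[i ->]|[i [j [_ ->]]]]; rewrite ?cards0 ?cards1 //.
by rewrite cards2; case: eqP.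
Qed.

(** No face has three elements, so [x_i x_j x_k] is a generator of [I_G]. *)
Lemma edge_prime_colon_SR i j f : (1 < #|[set i; j]|)%N ->
  edge_prime i j f -> SR_ideal K e (xprod K [set i; j] * f).
Proof.
move=> ij1; apply: ideal_gen_colon => _ [k kij ->].
have -> : xprod K [set i; j] * 'X_k = xprod K (k |: [set i; j]).
  by rewrite mulrC /xprod [RHS]big_setU1.
apply: nonface_SR_ideal => /face_card_le2.
by rewrite cardsU1 kij leqNgt !ltnS ij1.
Qed.

Lemma symbolic_colon_SR_pow F n f : (1 < #|F|)%N ->
  SR_symbolic_pow K e n f -> ideal_pow (SR_ideal K e) n (xprod K F ^+ n * f).
Proof.
move=> F1 If.
have [fF|nF] := boolp.pselect (is_face e F); last first.
  exact/mem_ideal_powX/nonface_SR_ideal.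
have [i [j [eij defF]]] := face_card_gt1 fF F1.
apply: ideal_pow_colon (If i j eij) => g.
by rewrite defF; apply: edge_prime_colon_SR; rewrite -defF.
Qed.

Lemma tofrac_xprod_neq0 F : tofrac (xprod K F) != 0.
Proof.
rewrite tofrac_eq0; apply/prodf_neq0 => l _.
by rewrite -msupp_eq0 msuppX.
Qed.

(** In [S_{x_F}] the factor [x_F ^ n] is absorbed by the denominator. *)
Lemma loc_ideal_colon T U F n :
  (forall f, T f -> U (xprod K F ^+ n * f)) ->
  forall q, loc_ideal T F q -> loc_ideal U F q.
Proof.
move=> TU q [p [k [Tp ->]]].
exists (xprod K F ^+ n * p), (n + k)%N; split; first exact: TU.
rewrite /frac_over tofracM tofracXn exprD -mulf_div divff ?mul1r //.
by rewrite expf_neq0 // tofrac_xprod_neq0.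
Qed.

Lemma loc_ideal_SR_symbolic n F : (1 < #|F|)%N -> forall q,
  loc_ideal (ideal_pow (SR_ideal K e) n) F q <->
  loc_ideal (SR_symbolic_pow K e n) F q.
Proof.
move=> F1 q; split.
  apply: (@loc_ideal_colon _ _ _ 0) => f; rewrite expr0 mul1r.
  exact: SR_pow_sub_symbolic.
by apply: (@loc_ideal_colon _ _ _ n) => f; apply: symbolic_colon_SR_pow.
Qed.

End SRPowers.

Section SecondLocalCohomology.
Variables (K : fieldType) (r : nat).
Implicit Types T U : {mpoly K[r]} -> Prop.

(** The same cocycle serves for both ideals, since its homogeneity and the
    possible primitives [b] on singletons are conditions on fractions alone,
    not on classes modulo the ideal. *)
Lemma locoh2_neq0_imp (A : zmodType) (w : 'I_r -> A) T U (d : A) :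
  (forall F : {set 'I_r}, (1 < #|F|)%N ->
     forall q, loc_ideal T F q <-> loc_ideal U F q) ->
  locoh_neq0 w T 2 d -> locoh_neq0 w U 2 d.
Proof.
move=> TU [z [zd zZ zB]]; exists z; split=> // [F F3|[b [bS zbU]]].
  by apply/TU; [rewrite F3 | apply: zZ].
apply: zB; exists b; split=> // F F2.
by apply/TU; [rewrite F2 | apply: zbU].
Qed.

Lemma locoh2_neq0_eq (A : zmodType) (w : 'I_r -> A) T U (d : A) :
  (forall F : {set 'I_r}, (1 < #|F|)%N ->
     forall q, loc_ideal T F q <-> loc_ideal U F q) ->
  locoh_neq0 w T 2 d = locoh_neq0 w U 2 d.
Proof.
move=> TU; apply/boolp.propext; split; apply: locoh2_neq0_imp => // F F1 q.
by apply: iff_sym; apply: TU.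
Qed.

End SecondLocalCohomology.

Theorem proposition3p18 (K : fieldType) (r : nat) (hr : (3 <= r)%N)
    (e : rel 'I_r) (e_sym : ssrbool.symmetric e) (e_irr : irreflexive e)
    (no_isolated : forall i : 'I_r, exists j : 'I_r, e i j) :
  (forall j n : nat, (1 <= n)%N ->
     a_inv_neg (ideal_pow (SR_ideal K e) n) 2 j =
     a_inv_neg (SR_symbolic_pow K e n) 2 j) /\
  (forall n : nat, (1 <= n)%N ->
     a_inv (ideal_pow (SR_ideal K e) n) 2 =
     a_inv (SR_symbolic_pow K e n) 2).
Proof.
have H2E (A : zmodType) (w : 'I_r -> A) n (d : A) :
    locoh_neq0 w (ideal_pow (SR_ideal K e) n) 2 d =
    locoh_neq0 w (SR_symbolic_pow K e n) 2 d.
  by apply: locoh2_neq0_eq => F; apply: loc_ideal_SR_symbolic.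
split=> [j n _|n _]; congr max_deg; apply/boolp.funext => t.
  by congr ex; apply/boolp.funext => a; rewrite H2E.
exact: H2E.
Qed.
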